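(* Let $\mathbb{K}$ be a field of characteristic zero and let $\mathfrak{g}$ be a finite-dimensional Lie algebra over $\mathbb{K}$. Then $\mathfrak{g}$ is semi-simple if and only if the following three conditions all hold: the derived ideal $[\mathfrak{g},\mathfrak{g}]$ coincides with $\mathfrak{g}$; every derivation of $\mathfrak{g}$ is inner; and the adjoint representation of $\mathfrak{g}$ is semi-simple.
   Context: A Lie algebra is semi-simple if its only commutative ideal is zero. A derivation of $\mathfrak{g}$ is inner if it is of the form $\mathrm{ad}\,x$ for some $x\in\mathfrak{g}$. A representation is semi-simple if it is a direct sum of simple (irreducible) representations. *)

(* Defs.v *)
From HB Require Import structures.
From mathcomp Require Import all_boot all_order all_algebra.

Set Implicit Arguments.
Unset Strict Implicit.
Unset Printing Implicit Defensive.

Import GRing.Theory.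
Local Open Scope ring_scope.

(* Finite dimensionality is part of the structure: Lie algebras are built on
   vectType. *)
HB.mixin Record Vector_isLieAlgebra (K : fieldType) g of Vector K g := {
  lie : g -> g -> g;
  lie_linearl : forall y : g, linear (fun x => lie x y);
  lie_linearr : forall x : g, linear (lie x);
  liexx : forall x : g, lie x x = 0;
  lie_jacobi : forall x y z : g,
    lie x (lie y z) + lie y (lie z x) + lie z (lie x y) = 0
}.

#[short(type="lieAlgType")]
HB.structure Definition LieAlgebra (K : fieldType) :=
  { g of Vector_isLieAlgebra K g & Vector K g }.

Section LieBracket.
Variables (K : fieldType) (g : lieAlgType K).
Implicit Types x y z : g.

HB.instance Definition _ x :=
  GRing.isLinear.Build K g g *:%R (lie x) (lie_linearr x).

HB.instance Definition _ := bilinear_isBilinear.Build K g g g *:%R *:%R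
  (@lie K g) (conj (@lie_linearl K g) (@lie_linearr K g)).

Lemma lieC x y : lie x y = - lie y x.
Proof.
apply/eqP; rewrite -addr_eq0; apply/eqP.
by have := liexx (x + y); rewrite linearDl !linearDr /= !liexx add0r addr0.
Qed.

End LieBracket.

Section LieAlgebraTheory.
Variables (K : fieldType) (g : lieAlgType K).

Definition lie_ideal (I : {vspace g}) : Prop :=
  forall x u : g, u \in I -> lie x u \in I.

Definition lie_commutative (I : {vspace g}) : Prop :=
  forall u v : g, u \in I -> v \in I -> lie u v = 0.

Definition lie_semisimple : Prop :=
  forall I : {vspace g}, lie_ideal I -> lie_commutative I -> I = 0%VS.

(* The span [U, V] of all the brackets of an element of U with an element of
   V, computed on bases as for prodv; lie_prodvP is the characterization. *)
Definition lie_prodv (U V : {vspace g}) : {vspace g} :=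
  <<[seq lie u v | u <- vbasis U, v <- vbasis V]>>%VS.

Lemma memv_lie (U V : {vspace g}) u v :
  u \in U -> v \in V -> lie u v \in lie_prodv U V.
Proof.
move=> Uu Vv; rewrite (coord_vbasis Uu) (coord_vbasis Vv).
rewrite linear_sumlz rpred_sum // => i _; rewrite linear_sum rpred_sum // => j _.
rewrite /= linearZl_LR linearZ /=; apply/memvZ/memvZ/memv_span.
by apply: allpairs_f; apply: mem_nth; rewrite size_tuple.
Qed.

Lemma lie_prodvP (U V W : {vspace g}) :
  (forall u v, u \in U -> v \in V -> lie u v \in W) <->
  (lie_prodv U V <= W)%VS.
Proof.
split=> [UVW | sUVW u v Uu Vv]; last exact: subvP sUVW _ (memv_lie Uu Vv).
apply/span_subvP=> _ /allpairsP[[u v] /= [Uu Vv ->]].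
by apply: UVW; apply: vbasis_mem.
Qed.

Definition derived_ideal : {vspace g} := lie_prodv fullv fullv.

Lemma derived_ideal_ideal : lie_ideal derived_ideal.
Proof. by move=> x u _; apply: memv_lie; apply: memvf. Qed.

Definition ad (x : g) : 'End(g) := linfun (lie x).

Lemma adE x y : ad x y = lie x y. Proof. by rewrite lfunE. Qed.

Definition derivation (D : 'End(g)) : Prop :=
  forall x y : g, D (lie x y) = lie (D x) y + lie x (D y).

Definition inner_derivation (D : 'End(g)) : Prop := exists x : g, D = ad x.

End LieAlgebraTheory.

Arguments lie_semisimple {K} g.
Arguments derived_ideal {K} g.

Record lie_repr (K : fieldType) (g : lieAlgType K) (V : vectType K) := LieRepr {
  lie_repr_fun :> {linear g -> 'End(V)};
  lie_repr_lie : forall x y : g, lie_repr_fun (lie x y) =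
    ((lie_repr_fun x \o lie_repr_fun y) - (lie_repr_fun y \o lie_repr_fun x))%VF
}.

Section Representations.
Variables (K : fieldType) (g : lieAlgType K) (V : vectType K).
Variable rho : lie_repr g V.

Definition subrepr (W : {vspace V}) : Prop :=
  forall x : g, (rho x @: W <= W)%VS.

(* The representation carried by the invariant subspace W is simple; the zero
   representation is not simple. *)
Definition simple_subrepr (W : {vspace V}) : Prop :=
  [/\ subrepr W, W <> 0%VS &
      forall U : {vspace V}, (U <= W)%VS -> subrepr U -> U = 0%VS \/ U = W].

(* The family is finite because V is finite-dimensional; it may be empty, so
   the zero representation is semi-simple. *)
Definition semisimple_repr : Prop :=
  exists (n : nat) (W : 'I_n -> {vspace V}),
    [/\ forall i, simple_subrepr (W i),
        directv (\sum_(i < n) W i) & (\sum_(i < n) W i)%VS = fullv].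

End Representations.

Section Adjoint.
Variables (K : fieldType) (g : lieAlgType K).

Fact ad_is_linear : linear (@ad K g).
Proof.
by move=> a x y; apply/lfunP=> z; rewrite add_lfunE scale_lfunE !adE linearPl.
Qed.

HB.instance Definition _ :=
  GRing.isLinear.Build K g 'End(g) *:%R (@ad K g) ad_is_linear.

Fact ad_lie (x y : g) : ad (lie x y) = ((ad x \o ad y) - (ad y \o ad x))%VF.
Proof.
apply/lfunP=> z; rewrite add_lfunE opp_lfunE !comp_lfunE !adE.
rewrite (lieC (lie x y)) (lieC x z) linearN opprK; apply/esym/eqP.
by rewrite -addr_eq0 lie_jacobi.
Qed.

Definition adjoint_repr : lie_repr g g := LieRepr ad_lie.

End Adjoint.

Arguments adjoint_repr {K} g.

(* Main.v *)
(** If [g] is a direct sum of simple ideals, an abelian ideal [I] has an ideal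
    complement [J], so [[g, g] <= J]; when [g] is perfect this forces [I = 0].

    Conversely, let [g] have no nonzero abelian ideal.  The main point is that an
    ideal meets its Killing orthogonal trivially: a minimal ideal in the
    intersection would be perfect and totally isotropic, hence made of
    ad-nilpotent elements by Cartan's criterion, contradicting Engel's theorem.
    So every ideal is complemented by its orthogonal, which gives complete
    reducibility and perfectness, and nondegeneracy of the Killing form makes
    every derivation inner.

    For Cartan's criterion one extends scalars to a splitting field of the
    characteristic polynomial of a single element. *)

From HB Require Import structures.
Require Import Defs.
From mathcomp Require Import all_boot all_order all_algebra fieldext.
From mathcomp Require Import ring.
From Stdlib Require Import Classical_Prop.

Set Implicit Arguments.
Unset Strict Implicit.
Unset Printing Implicit Defensive.

Import Order.TTheory GRing.Theory Num.Theory.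
Import passmx.
Local Open Scope ring_scope.

(** * Subspaces and semisimple representations *)

Section ExtremalSubspaces.
Variables (K : fieldType) (V : vectType K) (P : {vspace V} -> Prop).

(** Induction on codimension; [P] being arbitrary, excluded middle decides whether [U0] can be
    enlarged. *)
Lemma exists_max_vspace U0 : P U0 ->
  exists U, P U /\ forall U', P U' -> (U <= U')%VS -> U' = U.
Proof.
have [n] := ubnP (\dim {:V} - \dim U0); elim: n U0 => // n IHn U0 leUn PU0.
have [[U [PU sU neU]] | noU] :=
  classic (exists U, [/\ P U, (U0 <= U)%VS & U <> U0]).
  apply: (IHn U) => //; rewrite -ltnS; apply: leq_trans leUn.
  have ltU : (\dim U0 < \dim U)%N.
    rewrite ltnNge; apply/negP=> leU; apply/neU/eqP.
    by rewrite eq_sym eqEdim sU.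
  by rewrite ltnS ltn_sub2l // (leq_trans ltU) // dimvS // subvf.
exists U0; split=> // U PU sU; apply: NNPP => neU.
by case: noU; exists U.
Qed.

Lemma exists_min_vspace U0 : P U0 ->
  exists U, [/\ P U, (U <= U0)%VS & forall U', P U' -> (U' <= U)%VS -> U' = U].
Proof.
have [n] := ubnP (\dim U0); elim: n U0 => // n IHn U0 leUn PU0.
have [[U [PU sU neU]] | noU] :=
  classic (exists U, [/\ P U, (U <= U0)%VS & U <> U0]).
  have [|//|U' [PU' sU' minU']] := IHn U.
    rewrite -ltnS; apply: leq_trans leUn; rewrite ltnS ltnNge.
    by apply/negP=> leU; apply/neU/eqP; rewrite eqEdim sU.
  by exists U'; split=> //; apply: subv_trans sU.
exists U0; split=> // U PU sU; apply: NNPP => neU.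
by case: noU; exists U.
Qed.

End ExtremalSubspaces.

Section Semisimplicity.
Variables (K : fieldType) (g : lieAlgType K) (V : vectType K).
Variable rho : lie_repr g V.

Lemma subrepr0 : subrepr rho 0%VS.
Proof. by move=> x; rewrite limg0 subvv. Qed.

Lemma subreprI U W : subrepr rho U -> subrepr rho W -> subrepr rho (U :&: W)%VS.
Proof.
move=> rU rW x; apply: subv_trans (limg_cap _ _ _) _.
by rewrite capvS ?rU ?rW.
Qed.

Lemma subreprD U W : subrepr rho U -> subrepr rho W -> subrepr rho (U + W)%VS.
Proof. by move=> rU rW x; rewrite limgD addvS ?rU ?rW. Qed.

(** A maximal invariant [U'] meeting [U] trivially works: if a simple [W i] meets [U + U']
    trivially, then [U' + W i] still avoids [U], and maximality absorbs [W i] into [U']. *)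
Lemma semisimple_complement U : semisimple_repr rho -> subrepr rho U ->
  exists2 U', subrepr rho U' & (U + U' = fullv)%VS /\ (U :&: U' = 0)%VS.
Proof.
move=> [n [W [simW _ sumW]]] rU.
pose P U' := subrepr rho U' /\ (U :&: U' = 0)%VS.
have [|U' [[rU' UU'0] maxU']] := @exists_max_vspace _ _ P 0%VS.
  by split; [exact: subrepr0 | exact: capv0].
exists U' => //; split=> //.
apply/eqP; rewrite eqEsubv subvf -sumW; apply/subv_sumP => i _.
have [rW W0 minW] := simW i.
have [capW0 | <-] := minW (W i :&: (U + U'))%VS (capvSl _ _)
    (subreprI rW (subreprD rU rU')); last exact: capvSr.
suffices eqU' : (U' + W i)%VS = U'.
  by apply: subv_trans (addvSr U U'); rewrite -eqU' addvSr.
apply: maxU'; last exact: addvSl.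
split; first exact: subreprD.
apply/eqP; rewrite -subv0; apply/subvP => u /memv_capP[Uu].
case/memv_addP=> u' U'u' [w Ww def_u].
have : w \in (W i :&: (U + U'))%VS.
  rewrite memv_cap Ww -[w](addKr u') -def_u addrC.
  by rewrite memv_add // memvN.
rewrite capW0 memv0 => /eqP w0; move: def_u; rewrite w0 addr0 => def_u.
by rewrite -UU'0 memv_cap Uu def_u.
Qed.

(** Induction on the dimension of an invariant [U]: a minimal nonzero invariant [S] in [U] splits
    off, the modular law giving [U = S + (U :&: S')]. *)
Lemma complement_semisimple :
  (forall U, subrepr rho U ->
    exists2 U', subrepr rho U' & (U + U' = fullv)%VS /\ (U :&: U' = 0)%VS) ->
  semisimple_repr rho.
Proof.
move=> compl.
rewrite /semisimple_repr.
have: subrepr rho fullv by move=> x; apply: subvf.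
move: fullv => U; have [n] := ubnP (\dim U).
elim: n U => // n IHn U leUn rU; have [-> | U0] := eqVneq U 0%VS.
  exists 0%N, (fun=> 0%VS); split; [by case | | by rewrite big_ord0].
  by apply/directv_sumP => -[].
have [|S [[rS /eqP S0] sSU minS]] :=
  @exists_min_vspace _ _ (fun S => subrepr rho S /\ S <> 0%VS) U.
  by split; last exact/eqP.
have [S' rS' [SS'1 SS'0]] := compl S rS.
have defU : (S + U :&: S')%VS = U.
  by rewrite capvC vspace_modl // SS'1 capfv.
have capU : (S :&: (U :&: S') = 0)%VS.
  by rewrite capvA (capvC S) -capvA SS'0 capv0.
have dimU : (\dim U = \dim S + \dim (U :&: S'))%N.
  by rewrite -{1}defU dimv_disjoint_sum.
have [||m [W [simW dirW sumW]]] := IHn (U :&: S')%VS; last 1 first.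
- exists m.+1, (fun i => oapp W S (unlift ord0 i)); split.
  + move=> i; case: unliftP => [j _|_] /=; first exact: simW.
    split=> // [|T sT rT]; first exact/eqP.
    have [|T0] := eqVneq T 0%VS; [by left | right].
    by apply: minS => //; split=> //; apply/eqP.
  + rewrite directvE /= !big_ord_recl unlift_none /=.
    under eq_bigr do rewrite liftK /=.
    rewrite [X in (_ == _ + X)%N](eq_bigr (fun i => \dim (W i))).
      by have := directvP dirW; rewrite /= sumW => <-; rewrite dimv_disjoint_sum.
    by move=> i _; rewrite liftK.
  rewrite big_ord_recl unlift_none /=.
  by under eq_bigr do rewrite liftK /=; rewrite sumW.
- rewrite -ltnS; apply: leq_trans leUn; rewrite ltnS dimU.
  by rewrite -[ltnLHS]add0n ltn_add2r lt0n dimv_eq0.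
- exact: subreprI.
Qed.

End Semisimplicity.

(** * Engel's theorem *)

Section Ideals.
Variables (K : fieldType) (g : lieAlgType K).
Implicit Types (I J S U W : {vspace g}) (x y z : g).

Lemma lieDl x y z : lie (x + y) z = lie x z + lie y z.
Proof. exact: linearDl. Qed.

Lemma lieDr x y z : lie x (y + z) = lie x y + lie x z.
Proof. exact: linearD. Qed.

Lemma lieZl a x y : lie (a *: x) y = a *: lie x y.
Proof. exact: linearZl_LR. Qed.

Lemma lieZr a x y : lie x (a *: y) = a *: lie x y.
Proof. exact: linearZ. Qed.

Lemma lie_lie x y z : lie x (lie y z) = lie (lie x y) z + lie y (lie x z).
Proof.
have := ad_lie x y; move/lfunP/(_ z).
by rewrite add_lfunE opp_lfunE !comp_lfunE !adE => ->; rewrite subrK.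
Qed.

Lemma lie_ideal_subrepr I : lie_ideal I <-> subrepr (adjoint_repr g) I.
Proof.
split=> [idI x | rI x u Iu].
  by apply/subvP=> _ /memv_imgP[u Iu ->]; rewrite /= adE idI.
by rewrite -adE; apply/(subvP (rI x))/memv_img.
Qed.

Lemma lie_ideal_l I x u : lie_ideal I -> u \in I -> lie u x \in I.
Proof. by move=> idI Iu; rewrite lieC memvN idI. Qed.

Lemma lie_prodv_ideal I J : lie_ideal I -> lie_ideal J ->
  lie_ideal (lie_prodv I J).
Proof.
move=> idI idJ x.
have : (lie_prodv I J <= ad x @^-1: lie_prodv I J)%VS.
  apply/lie_prodvP => u v Iu Jv; rewrite -memv_preim adE lie_lie.
  by rewrite memvD ?memv_lie ?idI ?idJ.
by move/subvP=> sIJ u /sIJ; rewrite -memv_preim adE.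
Qed.

(* Relative form of Engel's theorem: working modulo [U] inside the ambient
   algebra avoids quotient representations. *)
Lemma engel S U W :
    (forall x y, x \in S -> y \in S -> lie x y \in S) ->
    (forall x, x \in S -> forall y, exists n, iter n (lie x) y = 0) ->
    (forall x u, x \in S -> u \in U -> lie x u \in U) ->
    (forall x w, x \in S -> w \in W -> lie x w \in W) ->
    (exists2 w, w \in W & w \notin U) ->
  exists w, [/\ w \in W, w \notin U & forall x, x \in S -> lie x w \in U].
Proof.
have [n] := ubnP (\dim S).
elim: n S U W => // n IHn S U W leSn algS nilS SU SW [w0 Ww0 Uw0].
have [S0 | nzS] := eqVneq S 0%VS.
  exists w0; split=> // x; rewrite S0 memv0 => /eqP->.
  by rewrite linear0l mem0v.
pose P (T : {vspace g}) := [/\ forall x y, x \in T -> y \in T -> lie x y \in T,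
  (T <= S)%VS & ~~ (S <= T)%VS].
have [|T [[algT sTS nTS] maxT]] := @exists_max_vspace _ _ P 0%VS.
  split; rewrite ?sub0v ?subv0 // => x y; rewrite !memv0 => /eqP-> /eqP->.
  by rewrite liexx.
have ltTn : (\dim T < n)%N.
  rewrite -ltnS; apply: leq_trans leSn; rewrite ltnS.
  rewrite ltnNge; apply: contra nTS => leST.
  by rewrite -(dimv_leqif_sup sTS) eqn_leq dimvS.
have nilT x : x \in T -> forall y, exists n, iter n (lie x) y = 0.
  by move=> /(subvP sTS)/nilS.
(* Acting on [S] modulo itself, the maximal proper subalgebra [T] is normalized by some [z] outside
   [T]; so [T + <[z]>] is a subalgebra, hence all of [S]. *)
have [||z [Sz Tz nzT]] := IHn T T S ltTn algT nilT algT.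
- by move=> x w /(subvP sTS) Sx; apply: algS.
- exact: subvPn.
have zT t : t \in T -> lie z t \in T by move=> Tt; rewrite lieC memvN nzT.
have defS u : u \in S -> exists2 t, t \in T & exists a, u = t + a *: z.
  have sTz : (T + <[z]> <= S)%VS by rewrite subv_add sTS -memvE.
  have [sSTz | nSTz] := boolP (S <= T + <[z]>)%VS.
    move/(subvP sSTz)/memv_addP=> [t Tt [_ /vlineP[a ->] ->]].
    by exists t => //; exists a.
  case/negP: Tz; suffices <- : (T + <[z]>)%VS = T.
    by apply: (subvP (addvSr _ _)); apply: memv_line.
  apply: maxT; last exact: addvSl.
  split=> // _ _ /memv_addP[t1 Tt1 [_ /vlineP[a ->] ->]]
    /memv_addP[t2 Tt2 [_ /vlineP[b ->] ->]].
  apply: (subvP (addvSl _ _)).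
  rewrite !lieDl !lieDr !lieZl !lieZr liexx !scaler0 addr0 addrAC.
  by rewrite !memvD ?memvZ ?nzT ?zT ?algT.
have sTU x u : x \in T -> u \in U -> lie x u \in U.
  by move=> /(subvP sTS); apply: SU.
have [||w [Ww Uw Tw]] := IHn T U W ltTn algT nilT sTU.
- by move=> x u /(subvP sTS); apply: SW.
- by exists w0.
(* [z] preserves [Q] as long as it does not send the vector into [U]; by nilpotence of [z], the last
   iterate of [w] outside [U] is the required vector. *)
pose Q v := [/\ v \in W, v \notin U & forall x, x \in T -> lie x v \in U].
have Qz v : Q v -> lie z v \notin U -> Q (lie z v).
  case=> Wv Uv Tv Uzv; split=> [|//|x Tx]; first exact: SW.
  rewrite lie_lie memvD // ?Tv ?nzT // SU // ?Tv //.
have [m] := nilS z Sz w.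
have: Q w by split.
elim: m w {Ww Uw Tw} => [|m IHm] w Qw.
  by move=> /= w0'; case: Qw => _; rewrite w0' mem0v.
have [Uzw _ | /(Qz _ Qw) Qzw] := boolP (lie z w \in U); last first.
  by rewrite iterSr; apply: IHm.
case: Qw => Ww Uw Tw; exists w; split=> // x /defS[t Tt [a ->]].
by rewrite lieDl lieZl memvD // ?memvZ // Tw.
Qed.

(** For a maximal proper [J]-stable [U] in [J], Engel's theorem gives [w] outside [U] with [[J, w]]
    inside [U]; then [J = U + <[w]>], so [[J, J]] lies in [U], against perfectness. *)
Lemma perfect_nil_ideal0 J : lie_ideal J -> lie_prodv J J = J ->
  (forall x, x \in J -> forall y, exists n, iter n (lie x) y = 0) -> J = 0%VS.
Proof.
move=> idJ perfJ nilJ; apply: NNPP => nzJ.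
pose P (U : {vspace g}) := [/\ forall x u, x \in J -> u \in U -> lie x u \in U,
  (U <= J)%VS & ~~ (J <= U)%VS].
have [|U [[JU sUJ nJU] maxU]] := @exists_max_vspace _ _ P 0%VS.
  split; rewrite ?sub0v ?subv0 //; last exact/eqP.
  by move=> x u _; rewrite !memv0 => /eqP->; rewrite linear0.
have [|||w [Jw Uw JwU]] := @engel J U J _ nilJ JU.
- by move=> x y _; apply: idJ.
- by move=> x y _; apply: idJ.
- exact: subvPn.
have sJUw : (J <= U + <[w]>)%VS.
  apply/negPn/negP => nJUw; case/negP: Uw.
  suffices <- : (U + <[w]>)%VS = U by apply: (subvP (addvSr _ _)); apply: memv_line.
  apply: maxU; last exact: addvSl.
  split=> //; last by rewrite subv_add sUJ -memvE.
  move=> x _ Jx /memv_addP[u Uu [_ /vlineP[a ->] ->]].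
  apply: (subvP (addvSl _ _)).
  by rewrite lieDr lieZr memvD ?memvZ ?JwU ?JU.
case/negP: nJU; rewrite -{1}perfJ; apply/lie_prodvP => x y Jx.
move/(subvP sJUw)/memv_addP=> [u Uu [_ /vlineP[a ->] ->]].
by rewrite lieDr lieZr memvD ?memvZ ?JwU ?JU.
Qed.

End Ideals.

(** * Splitting fields and the prime field *)

Section FieldExtensions.
Implicit Types K : fieldType.

Lemma irreducible_factor K (p : {poly K}) : (1 < size p)%N ->
  exists2 q, irreducible_poly q & q %| p.
Proof.
have [n] := ubnP (size p); elim: n p => // n IHn p lepn p_gt1.
have [irr_p | red_p] := classic (irreducible_poly p); first by exists p.
have [q [q_neq1 q_p neq_qp]] : exists q : {poly K}, [/\ size q != 1, q %| p & ~~ (q %= p)].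
  apply: NNPP => noq; apply: red_p; split=> // q q_neq1 q_p.
  by apply/negPn/negP=> neq_qp; case: noq; exists q.
have p0 : p != 0 by rewrite -size_poly_gt0 ltnW.
have q0 : q != 0 by apply: contraTneq q_p => ->; rewrite dvd0p.
have [||r irr_r r_q] := IHn q.
- rewrite -ltnS (leq_trans _ lepn) // ltnS ltn_neqAle dvdp_leq // andbT.
  by rewrite dvdp_size_eqp.
- by rewrite ltn_neqAle eq_sym q_neq1 size_poly_gt0.
by exists r => //; apply: dvdp_trans q_p.
Qed.

(** Roots of irreducible factors are adjoined one at a time, leaving a cofactor of smaller size;
    [%=] disregards the leading coefficient. *)
Lemma splitting_field K (p : {poly K}) : p != 0 ->
  exists (F : fieldType) (f : {rmorphism K -> F}) (rs : seq F),
    map_poly f p %= \prod_(r <- rs) ('X - r%:P).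
Proof.
have [n] := ubnP (size p); elim: n K p => // n IHn K p lepn p0.
have [p_le1 | p_gt1] := leqP (size p) 1.
  exists K, idfun, [::]; rewrite big_nil map_poly_id // -size_poly_eq1.
  by rewrite eqn_leq p_le1 size_poly_gt0.
have [q irr_q q_p] := irreducible_factor p_gt1.
have [L _ [z qz0 _]] := irredp_FAdjoin irr_q.
have /factor_theorem[s def_s] : root (map_poly (in_alg L) p) z.
  by apply: root_dvdp qz0; rewrite dvdp_map.
have s0 : s != 0.
  by apply: contraNneq p0 => s0; rewrite -(map_poly_eq0 (in_alg L)) def_s s0 mul0r.
have [|F [f [rs def_rs]]] := IHn L s _ s0.
  rewrite -ltnS (leq_trans _ lepn) // ltnS -(size_map_poly (in_alg L) p) def_s.
  by rewrite size_Mmonic ?monicXsubC // size_XsubC addn2.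
exists F, (f \o in_alg L), (f z :: rs).
rewrite map_poly_comp def_s rmorphM /= map_polyXsubC big_cons mulrC.
exact: eqp_mull.
Qed.

Lemma pchar0_rat_morphism K : [pchar K] =i pred0 ->
  inhabited {rmorphism rat -> K}.
Proof.
move=> charK; pose f := @ratr K.
have intr_inj0 : injective (intr : int -> K).
  move=> m n /eqP; rewrite -subr_eq0 -rmorphB /= => /eqP mn0.
  apply/eqP; rewrite -subr_eq0; apply/eqP; move: (m - n) mn0 => {m n} [] m.
    by move/eqP; rewrite -pmulrn ((pcharf0P K).1 charK) => /eqP->.
  by rewrite NegzE rmorphN /= => /eqP; rewrite oppr_eq0 -pmulrn ((pcharf0P K).1 charK).
have nz_int d : d != 0 -> d%:~R != 0 :> K.
  by rewrite -(inj_eq intr_inj0) rmorph0.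
(* [ratr] reads the reduced fraction; this evaluates it on any fraction for [x], so sums and
   products need no reduction. *)
have fE x n d : d != 0 -> x * d%:~R = n%:~R -> f x = n%:~R / d%:~R.
  move=> d0 def_n; have nd : numq x * d = n * denq x.
    apply: (@intr_inj rat); rewrite !rmorphM /= numqE -def_n; ring.
  apply/eqP; rewrite eqr_div ?nz_int ?denq_eq0 // -!rmorphM /=.
  by rewrite nd mulrC.
have fB : zmod_morphism f.
  move=> x y; rewrite (fE (x - y) (numq x * denq y - numq y * denq x)
    (denq x * denq y)) ?mulf_neq0 ?denq_eq0 //.
    rewrite /f /ratr !(rmorphM, rmorphB) /=.
    by field; rewrite !nz_int ?denq_eq0.
  by rewrite !(rmorphM, rmorphB) /= !numqE; ring.
have fM : monoid_morphism f.
  split=> [|x y]; first by rewrite /f /ratr divr1.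
  rewrite (fE (x * y) (numq x * numq y) (denq x * denq y)) ?mulf_neq0 ?denq_eq0 //.
    by rewrite /f /ratr !rmorphM /= invfM mulrACA.
  by rewrite !rmorphM /= !numqE mulrACA.
pose fadd := GRing.isZmodMorphism.Build rat K f fB.
pose fmul := GRing.isMonoidMorphism.Build rat K f fM.
pose F : {rmorphism rat -> K} := HB.pack f fadd fmul.
exact: (inhabits F).
Qed.

End FieldExtensions.

(** * Generalized eigenvectors and spectral idempotents *)

Section GeneralizedEigenvectors.
Variables (K : fieldType) (V : vectType K) (T : {linear V -> V}).
Variable J : {vspace V}.
Hypothesis JT : forall v, v \in J -> T v \in J.

Let D c v := T v - c *: v.

Let DC c d v : D c (D d v) = D d (D c v).
Proof.
rewrite /D ![T (_ - _)]linearB ![T (_ *: _)]linearZ /= !scalerBr !scalerA.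
by rewrite (mulrC c d) !opprB !addrA [LHS]addrAC [RHS]addrAC [X in X + _]addrAC.
Qed.

Let D0 c : D c 0 = 0.
Proof. by rewrite /D linear0 scaler0 subrr. Qed.

Let DJ c v : v \in J -> D c v \in J.
Proof. by move=> Jv; rewrite memvB ?memvZ ?JT. Qed.

Let iterDC n c d v : iter n (D c) (D d v) = D d (iter n (D c) v).
Proof. by elim: n => //= n ->; rewrite DC. Qed.

Let iterD_sum n c (I : Type) (r : seq I) (P : pred I) F :
  iter n (D c) (\sum_(i <- r | P i) F i) = \sum_(i <- r | P i) iter n (D c) (F i).
Proof.
by elim: n => //= n ->; rewrite /D linear_sum /= scaler_sumr -sumrB.
Qed.

Let iterDD n c u v : iter n (D c) (u + v) = iter n (D c) u + iter n (D c) v.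
Proof.
by elim: n => //= n ->; rewrite /D linearD /= scalerDr opprD addrACA.
Qed.

Let iterD_id n c v : v \in J -> iter n (D c) v \in J.
Proof. by move=> Jv; elim: n => //= n; apply: DJ. Qed.

(** [T - d] is injective modulo the stable [J] on generalized [c]-eigenvectors: induct on the
    nilpotency order with [(c - d) u = (T - d) u - (T - c) u]. *)
Lemma geigenvector_shift_mem m n c d v : c != d ->
  iter m (D c) v = 0 -> iter n (D d) v \in J -> v \in J.
Proof.
move=> neq_cd.
have step k u : iter k (D c) u = 0 -> D d u \in J -> u \in J.
  elim: k u => [u /= -> _ | k IHk u]; first exact: mem0v.
  rewrite iterSr => ku0 Ju; have Jcu : D c u \in J by rewrite IHk // DC DJ.
  rewrite -[u](scalerK (_ : c - d != 0)) ?subr_eq0 // memvZ //.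
  suffices -> : (c - d) *: u = D d u - D c u by rewrite memvB.
  by rewrite /D scalerBl opprB addrACA addrC subrKA addrC.
elim: n v => // n IHn v mv0; rewrite iterSr => /IHn Jv.
by apply: (step m) => //; apply: Jv; rewrite iterDC mv0 D0.
Qed.

(** [(T - c i)^n] kills the first term and keeps the others generalized eigenvectors; induction puts
    their images in [J], and [geigenvector_shift_mem] brings the terms back. *)
Lemma geigenvector_sum_mem n (I : eqType) (r : seq I) (c : I -> K) (v : I -> V) :
    uniq r -> injective c -> (forall i, iter n (D (c i)) (v i) = 0) ->
  \sum_(i <- r) v i \in J -> forall i, i \in r -> v i \in J.
Proof.
move=> uniq_r inj_c; elim: r v uniq_r => // i r IHr v /= /andP[r'i uniq_r] nilv.
rewrite big_cons => Jsum.
have Jr j : j \in r -> v j \in J.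
  move=> rj; apply: (@geigenvector_shift_mem n n (c j) (c i)) => //.
    by rewrite (inj_eq inj_c); apply: contraTneq rj => ->.
  apply: (IHr (fun k => iter n (D (c i)) (v k))) => // [k|].
    by elim: {2}(n) => [|q IHq] /=; rewrite ?nilv // iterDC IHq D0.
  by have := iterD_id n (c i) Jsum; rewrite iterDD nilv add0r iterD_sum.
move=> j; rewrite inE => /predU1P[-> | /Jr//].
have Jsumr : \sum_(k <- r) v k \in J by rewrite big_seq rpred_sum.
by rewrite -(rpredDr _ Jsumr).
Qed.

(** Terms with the same eigenvalue share their weight, so grouping them reduces to distinct
    eigenvalues. This shows that operators scalar on each generalized eigenspace of [T] preserve
    [J]. *)
Lemma geigenvector_weighted_sum_mem n (I : finType) (c w : I -> K) (v : I -> V) :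
    (forall i j, c i = c j -> w i = w j) ->
    (forall i, iter n (D (c i)) (v i) = 0) ->
  \sum_i v i \in J -> \sum_i w i *: v i \in J.
Proof.
move=> wc nilv Jsum; pose p i : seq_sub (codom c) := SeqSub (codom_f c i).
rewrite (partition_big p xpredT) //= rpred_sum // => s _.
have [i /eqP def_s | no_i] := pickP (fun i => p i == s); last first.
  by rewrite big_pred0 ?mem0v.
rewrite (eq_bigr (fun j => w i *: v j)); last first.
  by move=> j /eqP pj; rewrite (wc j i) //; move: pj; rewrite -def_s => -[].
rewrite -scaler_sumr memvZ //.
pose u t := \sum_(j | p j == t) v j; rewrite -/(u s).
apply: (@geigenvector_sum_mem n _ (index_enum _) (@ssval _ _) u) => [||k||].
- exact: index_enum_uniq.
- exact: val_inj.
- by rewrite iterD_sum big1 // => j /eqP<-; apply: nilv.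
- by rewrite (partition_big p xpredT) in Jsum.
- exact: mem_index_enum.
Qed.

End GeneralizedEigenvectors.

(** * Traces of nilpotent and idempotent matrices *)

Section MatrixTraces.
Variable K : fieldType.

(* A full-rank factorization [A = C R] replaces [A] by the smaller [R C]. *)
Lemma mxtrace_nilpotent n (A : 'M[K]_n) k : A ^+ k = 0 -> \tr A = 0.
Proof.
elim: k n A => [|k IHk] n A Ak0.
  by rewrite -[A]mulr1 -[1](expr0 A) Ak0 mulr0 mxtrace0.
move: (col_base A) (row_base A) (mulmx_base A) (col_base_full A) (row_base_free A).
move=> C R defA fullC freeR.
have Ap m : A ^+ m.+1 = C *m (R *m C) ^+ m *m R.
  elim: m => [|m IHm]; first by rewrite expr1 expr0 mulmx1.
  rewrite exprSr IHm [(R *m C) ^+ m.+1]exprSr -!mulmxE !mulmxA.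
  by rewrite -(mulmxA _ C R) defA.
rewrite -defA mxtrace_mulC; apply: (IHk _ (R *m C)).
apply: (row_full_inj fullC); apply: (row_free_inj freeR).
by rewrite /= -Ap Ak0 mulmx0 mul0mx.
Qed.

(** In a full-rank factorization [A = C R], idempotence cancels to [R C = 1], of size the rank. *)
Lemma mxtrace_idempotent n (A : 'M[K]_n) : A *m A = A -> \tr A = (\rank A)%:R.
Proof.
move: (col_base A) (row_base A) (mulmx_base A) (col_base_full A) (row_base_free A).
move=> C R defA fullC freeR AA; rewrite -{1}defA mxtrace_mulC.
suffices -> : R *m C = 1%:M by rewrite mxtrace1.
apply: (row_full_inj fullC); apply: (row_free_inj freeR).
by rewrite /= mulmx1 mulmxA -(mulmxA _ C R) defA AA.
Qed.

End MatrixTraces.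

Section SpectralIdempotents.
Variables (K : fieldType) (n' : nat).
Local Notation n := n'.+1.

(** Chinese remaindering modulo the coprime [('X - a i)^N], evaluated at [x]; their product vanishes
    at [x] by Cayley-Hamilton, as [N = size rs] bounds every multiplicity. *)
Lemma spectral_idempotents (x : 'M[K]_n) rs :
    char_poly x %= \prod_(r <- rs) ('X - r%:P) ->
  exists (k N : nat) (a : 'I_k -> K) (e : 'I_k -> 'M[K]_n),
    [/\ injective a, forall i, e i != 0,
        \sum_i e i = 1,
        forall i j, e i * e j = if i == j then e i else 0 &
        forall i, (x - (a i)%:M) ^+ N * e i = 0 /\ GRing.comm x (e i)].
Proof.
move=> def_rs; pose I := seq_sub rs; pose a (i : I) := ssval i; pose N := size rs.
have inj_a : injective a by apply: val_inj.
pose Q i := ('X - (a i)%:P) ^+ N; pose M := \prod_i Q i.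
have coQ i (P : pred I) : ~~ P i -> coprimep (\prod_(j | P j) Q j) (Q i).
  move=> P'i; elim/big_rec: _ => [|j p Pj cop]; first exact: coprime1p.
  rewrite coprimepMl cop andbT coprimep_expl // coprimep_expr //.
  rewrite coprimep_XsubC2 // subr_eq0 (inj_eq inj_a).
  by apply: contraNneq P'i => ->.
have hM p : M %| p -> horner_mx x p = 0.
  suffices xM : horner_mx x M = 0.
    by case/dvdpP=> q ->; rewrite rmorphM /= xM mulr0.
  suffices /dvdpP[q ->] : char_poly x %| M.
    by rewrite rmorphM /= Cayley_Hamilton mulr0.
  rewrite (eqp_dvdl _ def_rs) /M /Q prodrXl /N.
  suffices dvd_s s : {subset s <= rs} ->
    \prod_(r <- s) ('X - r%:P) %| (\prod_i ('X - (a i)%:P)) ^+ size s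
    by exact: dvd_s.
  elim: s => [|r s IHs] sub_s; first by rewrite big_nil dvd1p.
  rewrite big_cons exprS dvdp_mul //; last first.
    by apply: IHs => b sb; apply: sub_s; rewrite inE sb orbT.
  have sr : r \in rs by rewrite sub_s // mem_head.
  by rewrite (bigD1 (SeqSub sr)) //= dvdp_mulr.
have /fin_all_exists[u defu] i :
    exists u, u.1 * (\prod_(j | j != i) Q j) + u.2 * Q i = 1.
  by apply/Bezout_eq1_coprimepP/coQ; rewrite eqxx.
pose p i := (u i).1 * \prod_(j | j != i) Q j.
have Mi i : M = Q i * \prod_(j | j != i) Q j by rewrite /M (bigD1 i).
have Qp i j : j != i -> Q j %| p i.
  by move=> neq_ji; rewrite dvdp_mull // (bigD1 j) //= dvdp_mulr.
have p1 i : p i = 1 - (u i).2 * Q i by rewrite -(defu i) addrK.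
pose f i := horner_mx x (p i).
have ff i j : f i * f j = if i == j then f i else 0.
  have [<- | neq_ij] := eqVneq i j; rewrite -rmorphM /=.
    rewrite {2}p1 mulrBr mulr1 rmorphB /= [X in _ - X]hM ?subr0 //.
    by apply/dvdpP; exists ((u i).1 * (u i).2); rewrite (Mi i) /p; ring.
  apply: hM; have /dvdpP[q ->] : Q j %| p i by rewrite Qp // eq_sym.
  by apply/dvdpP; exists (q * (u j).1); rewrite (Mi j) /p; ring.
have sumf : \sum_i f i = 1.
  apply/esym/eqP; rewrite -subr_eq0 -rmorph_sum -(rmorph1 (horner_mx x)) -rmorphB /=.
  apply/eqP/hM; suffices dvd_s s : uniq s -> \prod_(i <- s) Q i %| 1 - \sum_i p i.
    exact/dvd_s/index_enum_uniq.
  elim: s => [|i s IHs] /=; first by rewrite big_nil dvd1p.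
  case/andP=> s'i uniq_s; rewrite big_cons Gauss_dvdp.
    rewrite IHs // andbT (bigD1 i) //= opprD addrA dvdp_sub //.
      by rewrite p1 subKr dvdp_mull.
    apply: (big_ind (fun q => Q i %| q)) => [|? ?|j ji]; first exact: dvdp0.
      exact: dvdp_add.
    by rewrite Qp // eq_sym.
  rewrite coprimep_sym big_seq; elim/big_rec: _ => [|j q sj coq]; first exact: coprime1p.
  rewrite coprimepMl coq andbT coprimep_expl // coprimep_expr //.
  rewrite coprimep_XsubC2 // subr_eq0 (inj_eq inj_a).
  by apply: contraNneq s'i => ->.
have xf i : (x - (a i)%:M) ^+ N * f i = 0 /\ GRing.comm x (f i).
  split; last by have := comm_horner_mx2 x 'X (p i); rewrite horner_mx_X.
  rewrite -{1}[x]horner_mx_X -(horner_mx_C x) -rmorphB -rmorphXn -rmorphM /=.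
  by apply: hM; rewrite (Mi i) /p mulrCA dvdp_mull.
(* Only nonzero idempotents are kept: the later sum of squares needs positive ranks. *)
pose A := [pred i | f i != 0].
exists #|A|, N, (a \o enum_val), (f \o enum_val); split=> //.
- exact: inj_comp inj_a enum_val_inj.
- by move=> i; have := enum_valP i.
- rewrite -sumf [RHS](bigID (fun i => f i == 0)) /= [X in _ = X + _]big1 ?add0r => [|i /eqP//].
  by rewrite -(big_enum_val (A := A) f).
- by move=> i j /=; rewrite ff (inj_eq enum_val_inj).
by move=> i; apply: xf.
Qed.

End SpectralIdempotents.

(** * Cartan's criterion *)

Section TraceForm.

(** Left multiplication by [X] and right multiplication by [Y] commute; splitting [X u - u Y] lowers
    [i] in one term and [j] in the other. *)
Lemma commutator_nilpotent (K : fieldType) n (X Y u : 'M[K]_n) i j :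
    X ^+ i *m u = 0 -> u *m Y ^+ j = 0 ->
  iter (i + j) (fun v => X *m v - v *m Y) u = 0.
Proof.
set f := fun v => _.
have fB k v w : iter k f (v - w) = iter k f v - iter k f w.
  elim: k => //= k ->; by rewrite /f mulmxBr mulmxBl !opprD addrACA.
have f0 k : iter k f 0 = 0 by rewrite -[X in iter k f X](subrr 0) fB subrr.
move def_k: (i + j)%N => k; elim: k i j def_k u => [|k IHk] i j def_k u Xu uY.
  by move: def_k Xu; case: i => // _; rewrite expr0 mul1mx.
rewrite iterSr fB; apply/eqP; rewrite subr_eq0; apply/eqP.
case: i def_k Xu => [|i] def_k Xu.
  by move: Xu; rewrite expr0 mul1mx => ->; rewrite mulmx0 mul0mx !f0.
case: j def_k uY => [|j] def_k uY.
  by move: uY; rewrite expr0 mulmx1 => ->; rewrite mulmx0 mul0mx !f0.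
rewrite (IHk i j.+1) ?(IHk i.+1 j) //.
- by case: def_k => <-; rewrite addnS addSn.
- by rewrite mulmxA Xu mul0mx.
- by rewrite -mulmxA mulmxE -exprS.
- by case: def_k.
- by rewrite mulmxA mulmxE -exprSr.
by rewrite -mulmxA uY mulmx0.
Qed.

(* A column of the matrix [H] built in the proof is a rational linear form on
   [rat^k] vanishing on the relations among the eigenvalues [a i] of [x]; [y] is
   the semisimple part of [x] with each [a i] replaced by [H i j].  Then
   [tr (x y) = 0] is one more rational relation among the [a i], and applying the
   form to it yields a vanishing sum of squares. *)
Lemma split_trace_nilpotent (K : fieldType) (phi : {rmorphism rat -> K}) n'
    (x : 'M[K]_n'.+1) (J : {vspace 'M[K]_n'.+1}) rs :
    char_poly x %= \prod_(r <- rs) ('X - r%:P) ->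
    (forall u, u \in J -> x *m u - u *m x \in J) ->
    (forall y, (forall u, u \in J -> y *m u - u *m y \in J) -> \tr (x *m y) = 0) ->
  exists N, x ^+ N = 0.
Proof.
move=> /spectral_idempotents[k [N [a [e [inj_a nz_e sum_e ee xe]]]]] Jx tr0.
pose rel (q : 'rV[rat]_k) := \sum_i phi (q 0 i) * a i = 0.
have relD b p q : rel p -> rel q -> rel (p + b *: q).
  rewrite /rel => relp relq; under eq_bigr do rewrite !mxE rmorphD rmorphM mulrDl /=.
  rewrite big_split /= relp add0r.
  rewrite (eq_bigr (fun i => phi b * (phi (q 0 i) * a i))) => [|i _].
    by rewrite -mulr_sumr relq mulr0.
  by rewrite mulrA.
have rel0 : rel 0 by rewrite /rel big1 // => i _; rewrite mxE rmorph0 mul0r.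
(* Relations are closed under linear combinations, so a maximal space of relations contains them
   all. *)
have [|U [relU maxU]] := @exists_max_vspace _ _
    (fun U : {vspace 'rV[rat]_k} => forall q, q \in U -> rel q) 0%VS.
  by move=> q; rewrite memv0 => /eqP->.
have {}maxU q : rel q -> q \in U.
  move=> relq; rewrite -(maxU (U + <[q]>)%VS) ?addvSl //.
    by apply: (subvP (addvSr _ _)); apply: memv_line.
  by move=> _ /memv_addP[p /relU relp [_ /vlineP[b ->] ->]]; apply: relD.
(* A projection with kernel [U]; the columns of its matrix [H] are the linear forms. *)
pose h := (\1 - projv U)%VF.
have [H hE] : exists H : 'M_k, forall q, h q = q *m H.
  by exists (lin1_mx h) => q; rewrite mul_rV_lin1.
have relH q : rel q -> q *m H = 0.
  by move/maxU => Uq; rewrite -hE add_lfunE opp_lfunE id_lfunE projv_id // subrr.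
have sumH j i0 i1 i2 i3 : a i0 - a i1 = a i2 - a i3 ->
    H i0 j - H i1 j = H i2 j - H i3 j.
  move=> eq_a; pose d i : 'rV[rat]_k := delta_mx 0 i.
  have sum_d i : \sum_l phi (d i 0 l) * a l = a i.
    rewrite (bigD1 i) //= big1 ?addr0 ?mxE ?eqxx ?rmorph1 ?mul1r // => l neq_li.
    by rewrite mxE eqxx (negPf neq_li) rmorph0 mul0r.
  have : rel (d i0 - d i1 - (d i2 - d i3)).
    rewrite /rel (eq_bigr (fun l => phi (d i0 0 l) * a l - phi (d i1 0 l) * a l
      - (phi (d i2 0 l) * a l - phi (d i3 0 l) * a l))) => [|l _].
      by rewrite !sumrB !sum_d eq_a subrr.
    by rewrite !mxE !rmorphB !mulrBl.
  move/relH/matrixP/(_ 0 j); rewrite !mulmxBl -!rowE !mxE => /eqP.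
  by rewrite subr_eq0 => /eqP.
have H0 : H = 0.
  apply/matrixP => i j; rewrite [RHS]mxE; pose y := \sum_l phi (H l j) *: e l.
  have Jy u : u \in J -> y *m u - u *m y \in J.
    move=> Ju; pose T : {linear 'M[K]_n'.+1 -> 'M[K]_n'.+1} := (mulmx x \- mulmxr x).
    pose v (p : 'I_k * 'I_k) := e p.1 *m u *m e p.2.
    have def_u : \sum_p v p = u.
      rewrite -(pair_bigA _ (fun l m => e l *m u *m e m)) /=.
      under eq_bigr do rewrite -mulmx_sumr sum_e mulmx1.
      by rewrite -mulmx_suml sum_e mul1mx.
    (* [e l u e m] is a generalized eigenvector of commutation with [x] for [a l - a m], and
       commutation with [y] scales it by [phi (H l j - H m j)]; by [sumH] this weight depends only
       on the eigenvalue. *)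
    suffices -> : y *m u - u *m y = \sum_p phi (H p.1 j - H p.2 j) *: v p.
      apply: (@geigenvector_weighted_sum_mem _ _ T _ _ (N + N)%N _
        (fun p => a p.1 - a p.2)); rewrite ?def_u //.
      + by move=> p q /(sumH j)->.
      move=> p; have [Xe _] := xe p.1; have [Ye /esym ce] := xe p.2.
      rewrite -[RHS](@commutator_nilpotent K _ (x - (a p.1)%:M) (x - (a p.2)%:M) (v p)
        N N).
      + apply: eq_iter => w /=.
        rewrite mulmxBl mulmxBr mul_scalar_mx mul_mx_scalar scalerBl.
        by rewrite !opprD addrACA.
      + by rewrite /v !mulmxA [X in X *m _ *m _]Xe !mul0mx.
      rewrite /v -mulmxA; suffices -> : e p.2 *m (x - (a p.2)%:M) ^+ N = 0.
        by rewrite mulmx0.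
      rewrite mulmxE -[RHS]Ye; apply: commrX; apply: commrB => //.
      exact: scalar_mxC.
    rewrite -(pair_bigA _ (fun l m => phi (H l j - H m j) *: (e l *m u *m e m))) /=.
    under eq_bigr do under eq_bigr do rewrite rmorphB /= scalerBl.
    under eq_bigr do rewrite sumrB.
    rewrite sumrB; congr (_ - _).
      rewrite /y mulmx_suml; apply: eq_bigr => l _.
      by rewrite -scaler_sumr -mulmx_sumr sum_e mulmx1 scalemxAl.
    rewrite exchange_big /= /y mulmx_sumr; apply: eq_bigr => l _.
    by rewrite -scaler_sumr -!mulmx_suml sum_e mul1mx scalemxAr.
  (* [(x - a l) e l] is nilpotent, so [x e l] and [a l *: e l] have the same trace. *)
  have tr_xe l : \tr (x *m e l) = a l * phi (\rank (e l))%:R.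
    have [xle /esym ce] := xe l.
    have ele : e l *m e l = e l by rewrite mulmxE ee eqxx.
    rewrite rmorph_nat -mxtrace_idempotent // -mxtraceZ.
    apply/eqP; rewrite -subr_eq0 -raddfB /=; apply/eqP.
    apply: (@mxtrace_nilpotent _ _ _ N.+1).
    rewrite -mul_scalar_mx -mulmxBl mulmxE exprMn_comm; last first.
      by apply/commr_sym/commrB => //; apply: scalar_mxC.
    have -> : e l ^+ N.+1 = e l.
      by elim: (N) => [|m IHm]; rewrite ?expr1 // exprS IHm -mulmxE.
    by rewrite exprS -mulrA xle mulr0.
  have relq : rel (\row_l (H l j * (\rank (e l))%:R)).
    rewrite /rel -[RHS](tr0 y Jy) /y mulmx_sumr raddf_sum; apply: eq_bigr => l _ /=.
    by rewrite mxE rmorphM /= -scalemxAr mxtraceZ tr_xe mulrA mulrAC -mulrA.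
  (* Column [j] of [H] on this relation: the squares [H l j ^ 2], weighted by the ranks of the
     [e l], sum to zero. *)
  have /matrixP/(_ 0 j) := relH _ relq; rewrite !mxE => /eqP.
  rewrite psumr_eq0 => [|l _].
    move/allP/(_ i (mem_index_enum _)) => /=.
    rewrite mxE !mulf_eq0 pnatr_eq0 mxrank_eq0 (negPf (nz_e i)) orbF orbb.
    by move/eqP.
  by rewrite mxE mulrAC mulr_ge0 ?ler0n // -expr2 sqr_ge0.
exists N; rewrite -[x ^+ N]mulr1 -sum_e mulr_sumr big1 // => i _.
(* Since [H = 0], every rational vector is a relation, in particular a unit vector. *)
have a0 : a i = 0.
  have Ud : delta_mx 0 i \in U.
    suffices -> : delta_mx 0 i = projv U (delta_mx 0 i) by apply: memv_proj.
    apply/eqP; rewrite -subr_eq0 -[X in X - _]id_lfunE -opp_lfunE -add_lfunE.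
    by rewrite -/h hE H0 mulmx0.
  have := relU _ Ud; rewrite /rel (bigD1 i) //= mxE !eqxx rmorph1 mul1r.
  by rewrite big1 ?addr0 // => l neq_li; rewrite mxE eqxx (negPf neq_li) rmorph0 mul0r.
by have [xei _] := xe i; rewrite -[RHS]xei a0 raddf0 subr0.
Qed.

End TraceForm.

Section CartanCriterion.

Lemma span_ind (K : fieldType) (V : vectType K) (X : seq V) (P : V -> Prop) :
    P 0 -> (forall u v, P u -> P v -> P (u + v)) ->
    (forall c u, P u -> P (c *: u)) -> {in X, forall u, P u} ->
  {in <<X>>%VS, forall u, P u}.
Proof.
move=> P0 PD PZ PX u; rewrite span_def -[X]in_tupleE big_tuple.
case/memv_sumP=> v Xv ->; apply: big_ind => // i _.
have /vlineP[c ->] := Xv i isT; apply/PZ/PX.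
exact: mem_tnth.
Qed.

(** The hypotheses bear on a spanning list so that they can be transported to a splitting field of
    [char_poly x], where [split_trace_nilpotent] applies. *)
Lemma cartan_nilpotent (K : fieldType) (charK : [pchar K] =i pred0) n
    (B : seq 'M[K]_n) (x : 'M[K]_n) :
    {in B &, forall a b, a *m b - b *m a \in <<B>>%VS} ->
    {in B &, forall a b, \tr (a *m b) = 0} ->
    x \in <<[seq a *m b - b *m a | a <- B, b <- B]>>%VS ->
  exists N, x ^+ N = 0.
Proof.
case: n B x => [|n] B x algB trB Bx; first by exists 1; rewrite flatmx0.
have [phi] := pchar0_rat_morphism charK.
have [F [f [rs def_rs]]] := splitting_field (monic_neq0 (char_poly_monic x)).
pose m (a : 'M_n.+1) := map_mx f a; pose J := <<map m B>>%VS.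
have mM a b : m (a *m b) = m a *m m b by exact: map_mxM.
have mB a b : m (a - b) = m a - m b by exact: map_mxB.
have m_span X : {in <<X>>%VS, forall u, m u \in <<map m X>>%VS}.
  apply: span_ind => [|u v Xu Xv|c u Xu|u Xu].
  - by rewrite /m map_mx0 mem0v.
  - by rewrite /m map_mxD memvD.
  - by rewrite /m map_mxZ memvZ.
  - by rewrite memv_span ?map_f.
have algJ : {in J &, forall u v, u *m v - v *m u \in J}.
  move=> u v Ju Jv; move: u Ju.
  apply: span_ind => [|u w Ju Jw|c u Ju|_ /mapP[a Ba ->]].
  - by rewrite mul0mx mulmx0 subrr mem0v.
  - by rewrite mulmxDl mulmxDr opprD addrACA memvD.
  - by rewrite -scalemxAl -scalemxAr -scalerBr memvZ.
  move: v Jv; apply: span_ind => [|u w Ju Jw|c u Ju|_ /mapP[b Bb ->]].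
  - by rewrite mul0mx mulmx0 subrr mem0v.
  - by rewrite mulmxDl mulmxDr opprD addrACA memvD.
  - by rewrite -scalemxAl -scalemxAr -scalerBr memvZ.
  by rewrite -!mM -mB m_span ?algB.
have trJ a u : a \in B -> u \in J -> \tr (m a *m u) = 0.
  move=> Ba; move: u; apply: span_ind => [|u v Ju Jv|c u Ju|_ /mapP[b Bb ->]].
  - by rewrite mulmx0 mxtrace0.
  - by rewrite mulmxDr mxtraceD Ju Jv addr0.
  - by rewrite -scalemxAr mxtraceZ Ju mulr0.
  by rewrite -mM trace_map_mx trB ?rmorph0.
have Jx : m x \in J.
  apply: m_span; apply: subvP Bx; apply/span_subvP.
  move=> _ /allpairsP[[a b] /= [Ba Bb ->]].
  exact: algB.
have [||y Jy|N] := @split_trace_nilpotent F (f \o phi) n (m x) J rs.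
- by rewrite /m -map_char_poly.
- by move=> u Ju; apply: algJ.
- move: x Bx {def_rs Jx}; apply:
    span_ind => [|u v Ju Jv|c u Ju|_ /allpairsP[[a b] /= [Ba Bb ->]]].
  + by rewrite /m map_mx0 mul0mx mxtrace0.
  + by rewrite /m map_mxD mulmxDl mxtraceD Ju Jv addr0.
  + by rewrite /m map_mxZ -scalemxAl mxtraceZ Ju mulr0.
  (* [tr([a, b] y) = tr(a [b, y])], and [[b, y]] lies in [J] because [y] normalizes it. *)
  rewrite mB !mM mulmxBl raddfB /= -!mulmxA [X in _ - X]mxtrace_mulC -mulmxA.
  rewrite -raddfB -mulmxBr /= trJ // -memvN opprB.
  by rewrite Jy // memv_span ?map_f.
move=> mxN; exists N; apply: (map_mx_inj (f := f)).
by rewrite rmorphXn /= mxN map_mx0.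
Qed.

End CartanCriterion.

(** * The Killing form *)

Section KillingForm.
Variables (K : fieldType) (g : lieAlgType K).
Implicit Types (I J : {vspace g}) (x y z : g) (D E : 'End(g)).

Let b := vbasis {:g}.
Let b_basis : basis_of {:g} b := vbasisP _.

Definition lfun_trace D := \tr (mxof b b D).

Fact lfun_trace_is_scalar : scalar lfun_trace.
Proof. by move=> a D E; rewrite /lfun_trace linearP mxtraceD mxtraceZ. Qed.

HB.instance Definition _ :=
  GRing.isLinear.Build K 'End(g) K *%R lfun_trace lfun_trace_is_scalar.

Lemma lfun_traceC D E : lfun_trace (D \o E)%VF = lfun_trace (E \o D)%VF.
Proof. by rewrite /lfun_trace !(mxof_comp _ _ b_basis) mxtrace_mulC. Qed.

(** A general [D] covers both the Killing form and the linear form attached to a derivation. *)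
Definition trace_ad D y := lfun_trace (D \o ad y)%VF.

Fact trace_ad_is_scalar D : scalar (trace_ad D).
Proof.
by move=> a y z; rewrite /trace_ad linearP comp_lfunDr -comp_lfunZr linearP.
Qed.

HB.instance Definition _ D :=
  GRing.isLinear.Build K g K *%R (trace_ad D) (trace_ad_is_scalar D).

Definition killing x := trace_ad (ad x).

HB.instance Definition _ x :=
  GRing.isLinear.Build K g K *%R (killing x) (trace_ad_is_scalar (ad x)).

Lemma killingC x y : killing x y = killing y x.
Proof. exact: lfun_traceC. Qed.

Lemma lfun_trace_commutator D E x :
  lfun_trace (((D \o E) - (E \o D)) \o ad x)%VF =
  lfun_trace (D \o ((E \o ad x) - (ad x \o E)))%VF.
Proof.
rewrite comp_lfunDl comp_lfunNl comp_lfunDr comp_lfunNr !linearB /=.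
rewrite -!comp_lfunA; congr (_ - _).
by rewrite lfun_traceC -comp_lfunA.
Qed.

Lemma killing_lie x y z : killing (lie x y) z = killing x (lie y z).
Proof. by rewrite /killing /trace_ad !ad_lie lfun_trace_commutator. Qed.

(* The orthogonal is the kernel of an endomorphism with values in [I], so that
   rank-nullity bounds its dimension from below. *)
Definition killing_orth I : {vspace g} :=
  lker (\sum_(u <- vbasis I) linfun (fun z => killing u z *: u)).

Let killing_sum I z :
  (\sum_(u <- vbasis I) linfun (fun z => killing u z *: u)) z =
  \sum_(i < \dim I) killing (vbasis I)`_i z *: (vbasis I)`_i.
Proof.
rewrite sum_lfunE big_tuple; apply: eq_bigr => i _; rewrite (tnth_nth 0).
pose T := fun z => killing (vbasis I)`_i z *: (vbasis I)`_i.
have linT : linear T by move=> a x y; rewrite /T linearP scalerDl scalerA.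
pose Tl : {linear g -> g} := HB.pack T (GRing.isLinear.Build K g g *:%R T linT).
exact: (lfunE Tl).
Qed.

Lemma killing_orthP I z :
  reflect (forall u, u \in I -> killing u z = 0) (z \in killing_orth I).
Proof.
rewrite memv_ker killing_sum; apply: (iffP eqP) => [sum0 u Iu | orth_z].
  have /freeP/(_ _ sum0) k0 := basis_free (vbasisP I).
  rewrite killingC (coord_vbasis Iu) linear_sum big1 // => i _.
  by rewrite linearZ /= killingC k0 mulr0.
rewrite big1 // => i _; rewrite orth_z ?scale0r // vbasis_mem //.
by apply: mem_nth; rewrite size_tuple.
Qed.

Lemma killing_orth_ideal I : lie_ideal I -> lie_ideal (killing_orth I).
Proof.
move=> idI x z /killing_orthP orth_z; apply/killing_orthP => u Iu.
by rewrite -killing_lie orth_z // lie_ideal_l.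
Qed.

Lemma killing_orth_complement I :
  (I :&: killing_orth I = 0)%VS -> (I + killing_orth I)%VS = fullv.
Proof.
move=> capI; apply/eqP; rewrite eqEdim subvf dimv_disjoint_sum //.
rewrite -(limg_ker_dim (\sum_(u <- vbasis I) linfun (fun z => killing u z *: u)) fullv).
rewrite capfv -/(killing_orth I) addnC leq_add2r dimvS //.
apply/subvP=> _ /memv_imgP[z _ ->]; rewrite killing_sum rpred_sum // => i _.
by rewrite memvZ // vbasis_mem // mem_nth // size_tuple.
Qed.

Hypothesis charK : [pchar K] =i pred0.

Lemma perfect_killing0_ideal J : lie_ideal J -> lie_prodv J J = J ->
  (forall x y, x \in J -> y \in J -> killing x y = 0) -> J = 0%VS.
Proof.
move=> idJ perfJ killJ; apply: perfect_nil_ideal0 => // x Jx.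
pose rho z := mxof b b (ad z); pose B := [seq rho u | u <- vbasis J].
(* Matrices act on row vectors, so [rho] reverses products. *)
have rho_lie u v : rho (lie u v) = rho v *m rho u - rho u *m rho v.
  by rewrite /rho ad_lie linearB /= !(mxof_comp _ _ b_basis).
have rho_span X : {in <<X>>%VS, forall u, rho u \in <<map rho X>>%VS}.
  apply: span_ind => [|u v Xu Xv|c u Xu|u Xu].
  - by rewrite /rho !linear0 mem0v.
  - by rewrite /rho !linearD memvD.
  - by rewrite /rho !linearZ memvZ.
  - by rewrite memv_span ?map_f.
have [|||N rhoN] := @cartan_nilpotent K charK _ B (rho x).
- move=> _ _ /mapP[u Ju ->] /mapP[v Jv ->]; rewrite -rho_lie rho_span //.
  by rewrite (span_basis (vbasisP J)) idJ // vbasis_mem.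
- move=> _ _ /mapP[u Ju ->] /mapP[v Jv ->]; rewrite -(mxof_comp _ _ b_basis).
  by rewrite -[LHS]/(killing v u) killJ // vbasis_mem.
- move: Jx; rewrite -{1}perfJ => /rho_span; apply: subvP; apply: sub_span.
  move=> _ /mapP[_ /allpairsP[[u v] /= [Ju Jv ->]] ->]; rewrite rho_lie.
  by apply/allpairsP; exists (rho v, rho u); split=> //=; apply: map_f.
move=> y; exists N; apply/eqP; rewrite -(rVof_eq0 b_basis); apply/eqP.
have -> : rVof b (iter N (lie x) y) = rVof b y *m rho x ^+ N.
  elim: N {rhoN} => [|N IHN]; first by rewrite expr0 mulmx1.
  by rewrite iterS -adE (rVof_app _ b_basis) IHN exprSr -mulmxA.
by rewrite rhoN mulmx0.
Qed.

Lemma semisimple_killing I :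
  lie_semisimple g -> lie_ideal I -> (I :&: killing_orth I = 0)%VS.
Proof.
move=> ssg idI; apply: NNPP => nz_cap.
pose P J := lie_ideal J /\ J <> 0%VS.
have [|J [[idJ nzJ] sJI minJ]] := @exists_min_vspace _ _ P (I :&: killing_orth I)%VS.
  split=> // x u /memv_capP[Iu Ou].
  by rewrite memv_cap idI // killing_orth_ideal.
(* [[J, J]] is an ideal inside the minimal [J]: it is zero and [J] is abelian, or it is [J]. *)
have [JJ0 | /eqP nzJJ] := eqVneq (lie_prodv J J) 0%VS.
  apply/nzJ/ssg => // u v Ju Jv; apply/eqP; rewrite -memv0 -JJ0.
  exact: memv_lie.
apply/nzJ/perfect_killing0_ideal => //.
  apply: minJ; first by split=> //; apply: lie_prodv_ideal.
  by apply/lie_prodvP => u v _; apply: idJ.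
move=> x y /(subvP sJI)/memv_capP[Ix _] /(subvP sJI)/memv_capP[_ /killing_orthP].
exact.
Qed.

(** The orthogonal of [[g, g]] is abelian, its brackets lying both in it and in [[g, g]]; hence it
    is zero. *)
Lemma semisimple_perfect : lie_semisimple g -> derived_ideal g = fullv.
Proof.
move=> ssg; have idD := @derived_ideal_ideal _ g.
have capD := semisimple_killing ssg idD.
suffices orth0 : killing_orth (derived_ideal g) = 0%VS.
  by rewrite -(killing_orth_complement capD) orth0 addv0.
apply: ssg; first exact: killing_orth_ideal.
move=> u v Ou Ov; apply/eqP; rewrite -memv0 -capD memv_cap.
by rewrite memv_lie ?memvf // killing_orth_ideal.
Qed.

(** Nondegeneracy yields [z] with [killing z y = tr(D ad y)]. The derivation [E = D - ad z]
    satisfies [killing (E x) y = tr(E ad [x, y]) = 0], so [E = 0]. *)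
Lemma semisimple_derivation_inner D :
  lie_semisimple g -> derivation D -> inner_derivation D.
Proof.
move=> ssg derD.
have cap1 : (fullv :&: killing_orth fullv = 0)%VS.
  by apply: semisimple_killing => // x u _; apply: memvf.
have nondeg z : (forall y, killing z y = 0) -> z = 0.
  move=> kz0; apply/eqP; rewrite -memv0 -cap1 capfv.
  by apply/killing_orthP => u _; rewrite killingC.
(* [T] is injective, hence onto; a preimage of [w] has the prescribed Killing products with the
   basis. *)
pose T := \sum_(u <- vbasis {:g}) linfun (fun z => killing u z *: u).
have T0 : lker T == 0%VS.
  by rewrite -[lker T]/(killing_orth fullv) -[X in X == _]capfv cap1.
pose w := \sum_(i < \dim {:g}) trace_ad D b`_i *: b`_i.
have [z kz] : exists z, forall y, killing z y = trace_ad D y.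
  have [v /eqP] : exists v, T v = w by exists (T^-1%VF w); apply: lker0_lfunVK.
  rewrite killing_sum -/b -subr_eq0 -sumrB => /eqP sum0.
  pose k (i : 'I_(\dim {:g})) :=
    killing b`_i v - trace_ad D b`_i.
  have /freeP/(_ k) k0 := basis_free b_basis.
  have {}k0 i : k i = 0.
    apply: k0; rewrite -[RHS]sum0; apply: eq_bigr => j _.
    by rewrite scalerBl.
  have eq_i (i : 'I_(\dim {:g})) : killing b`_i v = trace_ad D b`_i.
    by apply/eqP; rewrite -subr_eq0 -/(k i) k0.
  exists v => y; rewrite (coord_vbasis (memvf y)) !linear_sum.
  by apply: eq_bigr => i _; rewrite !linearZ -/b /= killingC eq_i.
pose E := D - ad z.
have derE x y : E (lie x y) = lie (E x) y + lie x (E y).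
  rewrite !add_lfunE !opp_lfunE !adE derD lie_lie linearBl linearBr /=.
  by rewrite opprD addrACA.
have adEx x : ad (E x) = ((E \o ad x) - (ad x \o E))%VF.
  apply/lfunP => y; rewrite add_lfunE opp_lfunE !comp_lfunE !adE derE.
  by rewrite addrK.
have trE x : lfun_trace (E \o ad x)%VF = 0.
  by rewrite comp_lfunDl comp_lfunNl linearB /= -[X in X - _]kz subrr.
exists z; apply/eqP; rewrite -subr_eq0 -/E; apply/eqP/lfunP => x.
rewrite zero_lfunE; apply: nondeg => y.
by rewrite /killing /trace_ad adEx lfun_trace_commutator -ad_lie trE.
Qed.

Lemma semisimple_adjoint :
  lie_semisimple g -> semisimple_repr (adjoint_repr g).
Proof.
move=> ssg; apply: complement_semisimple => I /lie_ideal_subrepr idI.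
exists (killing_orth I); first exact/lie_ideal_subrepr/killing_orth_ideal.
have capI := semisimple_killing ssg idI; split=> //.
exact: killing_orth_complement.
Qed.

End KillingForm.

(** * Equivalence of semi-simplicity with the three conditions *)

Theorem theorem14 (K : fieldType) (charK : [pchar K] =i pred0)
    (g : lieAlgType K) :
  lie_semisimple g <->
  [/\ derived_ideal g = fullv,
      forall D : 'End(g), derivation D -> inner_derivation D &
      semisimple_repr (adjoint_repr g)].
Proof.
split=> [ssg | [perf_g _ ss_ad] I idI abI].
  split; [exact: semisimple_perfect | | exact: semisimple_adjoint].
  by move=> D; apply: semisimple_derivation_inner.
have [|J /lie_ideal_subrepr idJ [IJ1 IJ0]] := @semisimple_complement _ _ _ _ I ss_ad.
  exact/lie_ideal_subrepr.
suffices J1 : J = fullv by rewrite -IJ0 J1 capvf.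
apply/eqP; rewrite eqEsubv subvf -perf_g; apply/lie_prodvP => x y _ _.
have /memv_addP[u Iu [v Jv ->]] : x \in (I + J)%VS by rewrite IJ1 memvf.
have /memv_addP[u' Iu' [v' Jv' ->]] : y \in (I + J)%VS by rewrite IJ1 memvf.
rewrite lieDl memvD ?(lie_ideal_l _ idJ Jv) //.
by rewrite lieDr (abI u u') // add0r idJ.
Qed.
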